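(* Let $A(s), C(s)$ be fixed $n\times n$ real polynomial matrices and let $\mathcal B(s), \mathcal D(s)$ be families of $n\times n$ interval polynomial matrices, with $\mathcal{BD}$ and $\mathcal B_E\mathcal D_E$ the subsets of $\mathcal B(s)\times\mathcal D(s)$ defined in the context. Then $B(s)A(s)+D(s)C(s)$ is stable for all $B(s)\in\mathcal B(s)$, $D(s)\in\mathcal D(s)$ if and only if $B(s)A(s)+D(s)C(s)$ is stable for all $B(s)\times D(s)\in \mathcal{BD}\cap \mathcal B_E\mathcal D_E$.
   Context: Stability: a polynomial is stable if all its zeros lie in the open left half plane; a square polynomial matrix is stable if its determinant is a stable polynomial. Kharitonov sets: for an interval polynomial (a set of real polynomials) $r(s)=\{\sum_{i=0}^m r_i s^i : r_i\in[r_i^L,r_i^U]\}$, the Kharitonov vertex set is $r_V(s)=\{r_1(s),r_2(s),r_3(s),r_4(s)\}$, where $r_1(s)=r_0^L+r_1^Ls+r_2^Us^2+r_3^Us^3+r_4^Ls^4+\dots$, $r_2(s)=r_0^L+r_1^Us+r_2^Us^2+r_3^Ls^3+r_4^Ls^4+\dots$, $r_3(s)=r_0^U+r_1^Ls+r_2^Ls^2+r_3^Us^3+r_4^Us^4+\dots$, $r_4(s)=r_0^U+r_1^Us+r_2^Ls^2+r_3^Ls^3+r_4^Us^4+\dots$ (the pattern of bounds $L,U$ is periodic of period 4 in the power of $s$, up to degree $m$). The Kharitonov edge set is $r_E(s)=\{\lambda r_i(s)+(1-\lambda)r_j(s): (i,j)\in\{(1,2),(2,4),(4,3),(3,1)\},\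 \lambda\in[0,1]\}$. Interval matrices: for each $i,j\in\{1,\dots,n\}$ let $B(ij)=\{b_{ij}^{(0)}+b_{ij}^{(1)}s+\dots+b_{ij}^{(m)}s^m : b_{ij}^{(k)}\in[\underline b_{ij}^{(k)},\overline b_{ij}^{(k)}]\}$ and $D(ij)=\{d_{ij}^{(0)}+d_{ij}^{(1)}s+\dots+d_{ij}^{(m)}s^m : d_{ij}^{(k)}\in[\underline d_{ij}^{(k)},\overline d_{ij}^{(k)}]\}$ be interval polynomials. Put $\mathcal B(s)=\{(b_{ij}(s))_{n\times n}: b_{ij}(s)\in B(ij)\}$ and $\mathcal D(s)=\{(d_{ij}(s))_{n\times n}: d_{ij}(s)\in D(ij)\}$; coefficients in different entries vary independently. Let $\mathcal B_V(ij),\mathcal D_V(ij)$ be the Kharitonov vertex sets and $\mathcal B_E(ij),\mathcal D_E(ij)$ the Kharitonov edge sets of $B(ij),D(ij)$. Let $S_n$ be the set of all bijections of $\{1,\dots,n\}$ onto itself and $T_n$ the set of all functions from $\{1,\dots,n\}$ into itself. $X\times Y$ denotes the Cartesian product, and $x\times y$ denotes the ordered pair $(x,y)$. Define: $\mathcal B_E(s)$: the set of $B(s)\in\mathcal B(s)$ for which there is $\sigma\in S_n$ such that, for every $i$ and $j$, $b_{ij}(s)\in\mathcal B_E(ij)$ if $j=\sigma(i)$ and $b_{ij}(s)\in\mathcal B_V(ij)$ if $j\ne\sigma(i)$. $\mathcal D_E(s)$: the set of $D(s)\in\mathcal D(s)$ for which there is $\sigma\in S_n$ such that, for every $i$ and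 $j$, $d_{ij}(s)\in\mathcal D_E(ij)$ if $j=\sigma(i)$ and $d_{ij}(s)\in\mathcal D_V(ij)$ if $j\ne\sigma(i)$. $\mathcal B_E\mathcal D_E=\mathcal B_E(s)\times\mathcal D_E(s)$ (the bijections for $B$ and for $D$ are chosen independently). $\mathcal{BD}$: the set of pairs $B(s)\times D(s)$ for which there is $\eta\in T_n$ such that, for every $i$ and $j$, $b_{ij}(s)\times d_{ij}(s)\in(\mathcal B_E(ij)\times\mathcal D_V(ij))\cup(\mathcal B_V(ij)\times\mathcal D_E(ij))$ if $j=\eta(i)$, and $b_{ij}(s)\times d_{ij}(s)\in\mathcal B_V(ij)\times\mathcal D_V(ij)$ if $j\neq\eta(i)$. *)

(* Defs.v *)
From HB Require Import structures.
From mathcomp Require Import all_boot all_order all_fingroup all_algebra.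
From mathcomp Require Import complex.
From mathcomp Require Import boolp classical_sets reals.

Set Implicit Arguments.
Unset Strict Implicit.
Unset Printing Implicit Defensive.

Import Order.TTheory GRing.Theory Num.Theory.

Local Open Scope classical_set_scope.
Local Open Scope ring_scope.

(* The zero polynomial is not stable; a nonzero constant is (it has no zeros). *)
Definition stable (R : realType) (p : {poly R}) : Prop :=
  forall z : R[i], root (map_poly (real_complex R) p) z -> complex.Re z < 0.

Definition stable_mx (R : realType) (n : nat) (M : 'M[{poly R}]_n) : Prop :=
  stable (\det M).

(* Bounds on the coefficients of a polynomial of degree at most m.  The degree
   may drop: neither bound of the coefficient of 'X^m is required to be
   nonzero. *)
Record interval_poly (R : realType) (m : nat) := IntervalPoly {
  lower : 'I_m.+1 -> R;
  upper : 'I_m.+1 -> R;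
  lower_le_upper : forall k, lower k <= upper k
}.

Definition poly_family (R : realType) (m : nat) (r : interval_poly R m) :
    set {poly R} :=
  [set \sum_(k < m.+1) c k *: 'X^k | c in
     [set c : 'I_m.+1 -> R | forall k, lower r k <= c k <= upper r k]].

(* The coefficient of 'X^k is the upper bound if item k %% 4 of pat is true,
   and the lower bound otherwise. *)
Definition kharitonov (R : realType) (m : nat) (r : interval_poly R m)
    (pat : seq bool) : {poly R} :=
  \sum_(k < m.+1)
     (if nth false pat (k %% 4) then upper r k else lower r k) *: 'X^k.

Definition kharitonov1 (R : realType) (m : nat) (r : interval_poly R m) :=
  kharitonov r [:: false; false; true; true].
Definition kharitonov2 (R : realType) (m : nat) (r : interval_poly R m) :=
  kharitonov r [:: false; true; true; false].
Definition kharitonov3 (R : realType) (m : nat) (r : interval_poly R m) :=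
  kharitonov r [:: true; false; false; true].
Definition kharitonov4 (R : realType) (m : nat) (r : interval_poly R m) :=
  kharitonov r [:: true; true; false; false].

Definition kharitonov_vertices (R : realType) (m : nat)
    (r : interval_poly R m) : set {poly R} :=
  [set kharitonov1 r; kharitonov2 r; kharitonov3 r; kharitonov4 r].

Definition poly_segment (R : realType) (p q : {poly R}) : set {poly R} :=
  [set l *: p + (1 - l) *: q | l in [set l : R | 0 <= l <= 1]].

Definition kharitonov_edges (R : realType) (m : nat)
    (r : interval_poly R m) : set {poly R} :=
  poly_segment (kharitonov1 r) (kharitonov2 r) `|`
  poly_segment (kharitonov2 r) (kharitonov4 r) `|`
  poly_segment (kharitonov4 r) (kharitonov3 r) `|`
  poly_segment (kharitonov3 r) (kharitonov1 r).

Definition interval_mx (R : realType) (n m : nat) :=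
  'I_n -> 'I_n -> interval_poly R m.

Definition mx_family (R : realType) (n m : nat) (B : interval_mx R n m) :
    set 'M[{poly R}]_n :=
  [set M | forall i j, poly_family (B i j) (M i j)].

Definition mx_edges (R : realType) (n m : nat) (B : interval_mx R n m) :
    set 'M[{poly R}]_n :=
  [set M | mx_family B M /\
     exists sigma : 'S_n, forall i j,
       if j == sigma i then kharitonov_edges (B i j) (M i j)
       else kharitonov_vertices (B i j) (M i j)].

Definition mx_edge_pairs (R : realType) (n m : nat) (B D : interval_mx R n m) :
    set ('M[{poly R}]_n * 'M[{poly R}]_n) :=
  mx_edges B `*` mx_edges D.

Definition mx_row_edge_pairs (R : realType) (n m : nat)
    (B D : interval_mx R n m) : set ('M[{poly R}]_n * 'M[{poly R}]_n) :=
  [set P | (mx_family B `*` mx_family D) P /\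
     exists eta : {ffun 'I_n -> 'I_n}, forall i j : 'I_n,
       if j == eta i then
         ((kharitonov_edges (B i j) `*` kharitonov_vertices (D i j)) `|`
          (kharitonov_vertices (B i j) `*` kharitonov_edges (D i j)))
           (P.1 i j, P.2 i j)
       else
         (kharitonov_vertices (B i j) `*` kharitonov_vertices (D i j))
           (P.1 i j, P.2 i j)].

(* Main.v *)
Require Import Defs.
From HB Require Import structures.
From mathcomp Require Import all_boot all_order all_fingroup all_algebra.
From mathcomp Require Import complex.
From mathcomp Require Import boolp classical_sets reals.
From mathcomp Require Import topology normedtype derive.
From mathcomp Require Import ring lra zify.

Set Implicit Arguments.
Unset Strict Implicit.
Unset Printing Implicit Defensive.

Import Order.TTheory GRing.Theory Num.Theory.
Import numFieldNormedType.Exports.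

Local Open Scope classical_set_scope.
Local Open Scope ring_scope.

(** Join the two matrices into N = row_mx B D and put W = col_mx A C, so that
B A + D C = N W.  The determinant of N W is affine in each entry of N, and it
is jointly affine in two entries of N that share a row or a column: for a
common column, the coefficient of their product is a determinant with two equal
rows (det_set_entry2).

First, zeros on the imaginary axis.  Suppose that some member of the family has
a zero there.  The idea is to let the zero slide along the axis while entries
are replaced by simpler ones.  Fix all entries but one.  At i w the values of an
interval polynomial fill the rectangle spanned by its Kharitonov polynomials
(kharitonov_rectangle), so the determinant takes there the values
F + l G + u H with l and u in [0, 1], for real polynomials F, G, H.  Take such a
zero with |w| as small as possible.  If (l, u) is interior, G (i w) and H (i w)
are linearly dependent over the reals: otherwise the equation can be solved for
(l, u) near w, and w could be moved closer to 0; at w = 0 dependence is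
automatic, because all values are real.  Moving (l, u) along the dependence
reaches the boundary of the square (parallelogram_exit), where the entry lies
on a Kharitonov edge.  Do this for every entry (reduce_to_edges).  The same
argument applied to two edge entries on a common line makes one of them a vertex
(edge_pair_to_vertex); repeating it leaves at most one nonvertex entry in each
row and each column of N (reduce_to_scattered_edges).  Such an N belongs to both
sets of pairs (scattered_edges_mem): the nonvertex entries of B, and those of D,
form a partial injection, which extends to a permutation.  Hence no member of
the family has a zero on the imaginary axis.

Second, stability.  Degrees may drop, so the absence of imaginary zeros is not
enough by itself: in 1 - t s a zero goes from one half plane to the other
through infinity.  Replace the vertices of a vertex matrix one at a time by
arbitrary members of the interval polynomials.  At each step the determinant is
x P + Q, with P and Q fixed.  Look at the coefficient in the largest degree
that x P + Q can have: it depends only on the highest coefficient of x that is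
free to vary, and it does so affinely.  Therefore some vertex v gives it a
nonzero value whose sign is not opposite to that of the value given by x, and
the degree is constant on the segment from v P + Q to x P + Q, except perhaps at
the end.  Along such a
segment stability propagates (stable_segment): it is an open condition where the
degree is full (stable_open), and a limit of stable polynomials without zeros
on the axis is stable (stable_limit). *)

(** * Moving parallelograms *)

Definition on_square_boundary (R : numDomainType) (l m : R) : bool :=
  [&& 0 <= l <= 1, 0 <= m <= 1 & [|| l == 0, l == 1, m == 0 | m == 1]].

(** Follow the line of direction (a, b) until the first of the two coordinates
leaves [0, 1]. *)
Lemma square_exit (R : realFieldType) (a b l m : R) :
  (a != 0) || (b != 0) -> 0 <= l <= 1 -> 0 <= m <= 1 ->
  exists s : R, on_square_boundary (l + s * a) (m + s * b).
Proof.
have exit1 (c k : R) : c != 0 -> 0 <= k <= 1 ->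
    exists2 s, 0 <= s & (k + s * c == if 0 < c then 1 else 0).
  move=> c0 /andP[k0 k1]; case: ifP => cpos.
    exists ((1 - k) / c); first by rewrite divr_ge0 ?subr_ge0 // ltW.
    by rewrite divfK // addrC subrK.
  exists (- k / c); last by rewrite divfK // subrr.
  by rewrite -mulrNN opprK -invrN divr_ge0 // oppr_ge0 leNgt cpos.
case: (eqVneq a 0) => [-> /= b0 lI mI|a0 _ lI mI].
  have [s _ /eqP es] := exit1 b m b0 mI.
  exists s; rewrite /on_square_boundary mulr0 addr0 lI es.
  by case: ifP; rewrite ?eqxx ?lexx ?ler01 ?orbT.
have [s s0 /eqP es] := exit1 a l a0 lI.
have [mJ|mJ] := boolP (0 <= m + s * b <= 1).
  exists s; rewrite /on_square_boundary mJ es.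
  by case: ifP; rewrite ?eqxx ?lexx ?ler01 ?orbT.
have b0 : b != 0 by apply: contra mJ => /eqP->; rewrite mulr0 addr0.
(* m leaves [0, 1] before l does *)
have [u u0 /eqP eu] := exit1 b m b0 mI.
exists u; rewrite /on_square_boundary eu; apply/and3P; split.
- have us : u <= s.
    move: eu mJ; case: (ltrgtP 0 b) b0 => // bs _ eu; rewrite negb_and -!ltNge.
      by case/orP => h; nra.
    by case/orP => h; nra.
  by move: es lI; case: (ltrgtP 0 a) a0 => // sa _ es /andP[l0 l1]; nra.
- by case: ifP; rewrite ?eqxx ?lexx ?ler01.
- by case: ifP; rewrite ?eqxx ?orbT.
Qed.

(** Positivity of finitely many polynomials at w persists on w (1 - t) for
small t. *)
Lemma pos_closer_to0 (R : realType) (s : seq {poly R}) (w : R) : w != 0 ->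
  (forall p, p \in s -> 0 < p.[w]) ->
  exists2 v : R, v ^+ 2 < w ^+ 2 & forall p, p \in s -> 0 < p.[v].
Proof.
move=> w0 pos.
have nearpos : \forall v \near w, forall p, p \in s -> 0 < p.[v].
  elim: s pos => [|q s ih] pos; first by near=> v.
  have ihs : \forall v \near w, forall p, p \in s -> 0 < p.[v].
    by apply: ih => p ps; apply: pos; rewrite inE ps orbT.
  have posq : \forall v \near w, 0 < q.[v].
    have q0 : 0 < q.[w] by apply: pos; rewrite inE eqxx.
    by have /cvgr_gt := @continuous_horner R q w; apply.
  near=> v => p; rewrite inE => /predU1P[->|]; first by near: v.
  by move: p; near: v.
case/nbhs_ballP: nearpos => e /= e0 he.
pose t : R := Num.min (1 / 2) (e / (2 * `|w|)).
have nw : 0 < `|w| by rewrite normr_gt0.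
have t0 : 0 < t by rewrite lt_min !divr_gt0 // mulr_gt0.
have t1 : t <= 1 / 2 by rewrite ge_min lexx.
exists (w * (1 - t)).
  rewrite exprMn -subr_gt0; have : 0 < w ^+ 2 by rewrite exprn_even_gt0.
  by move=> w2; nra.
apply: he; rewrite /ball /= mulrBr mulr1 opprB addrCA subrr addr0.
rewrite normrM (gtr0_norm t0).
apply: (@le_lt_trans _ _ (`|w| * (e / (2 * `|w|)))).
  by rewrite ler_pM2l // ge_min lexx orbT.
by have -> : `|w| * (e / (2 * `|w|)) = e / 2; [field; rewrite gt_eqF|lra].
Unshelve. all: by end_near. Qed.

(** The two equations say that 0 belongs to the parallelogram
f + [0, 1] g + [0, 1] h in the plane, whose vertices move with w.  Since the
second coordinates of g and h vanish at 0, the parallelogram is degenerate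
there.  So on the way to 0 either the origin crosses the boundary of the
parallelogram, or the parallelogram flattens while it contains the origin, and
then every point of it is also on its boundary. *)
Lemma parallelogram_exit (R : realType) (f1 g1 h1 f2 g2 h2 : {poly R})
    (l m w : R) :
  g2.[0] = 0 -> h2.[0] = 0 -> 0 <= l <= 1 -> 0 <= m <= 1 ->
  f1.[w] + l * g1.[w] + m * h1.[w] = 0 ->
  f2.[w] + l * g2.[w] + m * h2.[w] = 0 ->
  exists l' m' w', [/\ on_square_boundary l' m',
    f1.[w'] + l' * g1.[w'] + m' * h1.[w'] = 0 &
    f2.[w'] + l' * g2.[w'] + m' * h2.[w'] = 0].
Proof.
move=> g20 h20 lI mI e1 e2.
pose ev (f g h : {poly R}) (x : R * R * R) :=
  f.[x.2] + x.1.1 * g.[x.2] + x.1.2 * h.[x.2].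
have cev f g h : continuous (ev f g h).
  move=> x; apply: cvgD; first apply: cvgD.
  - by apply: (cvg_comp _ _ cvg_snd); exact: continuous_horner.
  - apply: cvgM; first by apply: (cvg_comp _ _ cvg_fst); exact: cvg_fst.
    by apply: (cvg_comp _ _ cvg_snd); exact: continuous_horner.
  - apply: cvgM; first by apply: (cvg_comp _ _ cvg_fst); exact: cvg_snd.
    by apply: (cvg_comp _ _ cvg_snd); exact: continuous_horner.
pose K : set (R * R * R) := (`[0, 1] `*` `[0, 1] `*` `[- `|w|, `|w|]) `&`
  ((ev f1 g1 h1 @^-1` [set 0]) `&` (ev f2 g2 h2 @^-1` [set 0])).
have cK : compact K.
  apply: compact_closedI.
    by apply: compact_setX; [apply: compact_setX|]; exact: segment_compact.
  have closed0 f g h : closed (ev f g h @^-1` [set 0]).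
    by apply: preimage_closed; [move=> x _; exact: cev|exact: closed_eq].
  by apply: closedI; apply: closed0.
have K0 : K !=set0.
  exists (l, m, w); split; last by split.
  by split; [split|]; rewrite /= in_itv //= lerNnormlW ?ler_norm.
have cw : {within K, continuous (fun x : R * R * R => ('X^2 : {poly R}).[x.2])}.
  apply: continuous_subspaceT => x.
  by apply: (cvg_comp _ _ cvg_snd); exact: continuous_horner.
(* a solution with the parameter closest to 0 *)
have [[[l1 m1] w1] +] := compact_EVT_min K0 cK cw.
rewrite inE => -[[[/= l1I m1I] w1I] [z1 z2]] minw.
rewrite /= !in_itv /= in l1I m1I w1I; rewrite /ev /= in z1 z2.
pose Dl := g1 * h2 - g2 * h1.
have [D0|D0] := eqVneq Dl.[w1] 0.
  (* flat case: move along a linear relation between g and h *)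
  have [a [b [ab ka kb]]] : exists a b : R, [/\ (a != 0) || (b != 0),
      a * g1.[w1] + b * h1.[w1] = 0 & a * g2.[w1] + b * h2.[w1] = 0].
    move: D0; rewrite /Dl !hornerE => D0.
    have [h1z|h1z] := eqVneq h1.[w1] 0; last first.
      exists h1.[w1], (- g1.[w1]); split; [by rewrite h1z|ring|].
      by rewrite -[RHS]oppr0 -D0; ring.
    have [h2z|h2z] := eqVneq h2.[w1] 0; last first.
      exists h2.[w1], (- g2.[w1]); split; [by rewrite h2z| |ring].
      by rewrite -[RHS]D0; ring.
    exists 0, 1; split; [by rewrite oner_eq0 orbT| |];
      by rewrite mul0r mul1r add0r.
  have [s hs] := square_exit ab l1I m1I.
  exists (l1 + s * a), (m1 + s * b), w1; split=> //.
  - by rewrite -[RHS]addr0 -{1}z1 -(mulr0 s) -ka; ring.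
  - by rewrite -[RHS]addr0 -{1}z2 -(mulr0 s) -kb; ring.
have [bd|nbd] := boolP (on_square_boundary l1 m1); first by exists l1, m1, w1.
have [[l1a l1b] [m1a m1b]] : (0 < l1 /\ l1 < 1) /\ (0 < m1 /\ m1 < 1).
  move: nbd; rewrite /on_square_boundary l1I m1I /= !negb_or.
  case/and4P=> l1z l11 m1z m11; case/andP: l1I => ? ?; case/andP: m1I => ? ?.
  by rewrite !lt_def l1z m1z [1 == _]eq_sym l11 [1 == _]eq_sym m11.
(* Cramer's rule: L / Dl and M / Dl are the only solutions near w1; being in
   (0, 1) at w1, they remain there closer to 0, against minimality *)
pose L := h1 * f2 - f1 * h2; pose M := f1 * g2 - g1 * f2.
have eL : L.[w1] = l1 * Dl.[w1].
  rewrite /L /Dl !hornerE.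
  have -> : f1.[w1] = - l1 * g1.[w1] - m1 * h1.[w1] by lra.
  have -> : f2.[w1] = - l1 * g2.[w1] - m1 * h2.[w1] by lra.
  ring.
have eM : M.[w1] = m1 * Dl.[w1].
  rewrite /M /Dl !hornerE.
  have -> : f1.[w1] = - l1 * g1.[w1] - m1 * h1.[w1] by lra.
  have -> : f2.[w1] = - l1 * g2.[w1] - m1 * h2.[w1] by lra.
  ring.
have w10 : w1 != 0.
  by apply: contraNneq D0 => ->; rewrite !hornerE g20 h20 mulr0 mul0r subr0.
have D2 : 0 < Dl.[w1] ^+ 2 by rewrite exprn_even_gt0.
have [v vw1 pos] : exists2 v : R, v ^+ 2 < w1 ^+ 2 & forall p,
    p \in [:: L * Dl; Dl ^+ 2 - L * Dl; M * Dl; Dl ^+ 2 - M * Dl] -> 0 < p.[v].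
  apply: pos_closer_to0 => // p; rewrite !inE.
  have sq N k : N.[w1] = k * Dl.[w1] -> (N * Dl).[w1] = k * Dl.[w1] ^+ 2.
    by rewrite hornerM => ->; ring.
  case/or4P=> /eqP->; rewrite ?hornerD ?hornerN ?[(Dl ^+ 2).[_]]horner_exp;
    rewrite ?(sq _ _ eL) ?(sq _ _ eM); by [rewrite mulr_gt0|nra].
have /= p1 : 0 < (L * Dl).[v] by apply: pos; rewrite !inE eqxx.
have /= p2 : 0 < (Dl ^+ 2 - L * Dl).[v] by apply: pos; rewrite !inE eqxx ?orbT.
have /= p3 : 0 < (M * Dl).[v] by apply: pos; rewrite !inE eqxx ?orbT.
have /= p4 : 0 < (Dl ^+ 2 - M * Dl).[v] by apply: pos; rewrite !inE eqxx ?orbT.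
have Dv : Dl.[v] != 0.
  by apply: contraTneq p1; rewrite hornerM => ->; rewrite mulr0 ltxx.
have unit_ratio (N : {poly R}) : 0 < (N * Dl).[v] ->
    0 < (Dl ^+ 2 - N * Dl).[v] -> 0 <= N.[v] / Dl.[v] <= 1.
  have Dv2 : 0 < Dl.[v] ^+ 2 by rewrite exprn_even_gt0.
  have -> : N.[v] / Dl.[v] = (N * Dl).[v] / Dl.[v] ^+ 2.
    by rewrite hornerM; field.
  rewrite hornerD hornerN [(Dl ^+ 2).[v]]horner_exp => q1 q2.
  apply/andP; split; first by rewrite divr_ge0 // ltW.
  by rewrite ler_pdivrMr // mul1r; lra.
have := minw (L.[v] / Dl.[v], M.[v] / Dl.[v], v).
rewrite leNgt /= !hornerXn vw1 => /(_ _).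
apply: contraPP => _; apply/not_implyP; split=> //.
rewrite inE; split.
  split; [split|]; rewrite /= in_itv /=.
  - exact: unit_ratio.
  - exact: unit_ratio.
  - have w1n : `|w1| <= `|w| by rewrite ler_norml.
    rewrite -ler_norml; apply: le_trans w1n.
    by rewrite -ler_sqr ?nnegrE // !real_normK ?num_real // ltW.
by split; rewrite /ev /= /L /M /Dl !hornerE; field; move: Dv;
  rewrite /Dl !hornerE.
Qed.

(** * Values on the imaginary axis *)

Definition iaxis (R : realType) (w : R) (p : {poly R}) : R[i] :=
  (map_poly (real_complex R) p).[Complex 0 w].

Definition imag_root (R : realType) (p : {poly R}) : Prop :=
  exists w, iaxis w p = 0.

Lemma iaxisD (R : realType) (w : R) (p q : {poly R}) :
  iaxis w (p + q) = iaxis w p + iaxis w q.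
Proof. by rewrite /iaxis rmorphD hornerD. Qed.

Lemma iaxisM (R : realType) (w : R) (p q : {poly R}) :
  iaxis w (p * q) = iaxis w p * iaxis w q.
Proof. by rewrite /iaxis rmorphM hornerM. Qed.

(** The even part of a real polynomial is real on the imaginary axis, and the
odd part is imaginary; the two can thus be prescribed separately. *)
Lemma iaxisE (R : realType) (w : R) (p : {poly R}) :
  iaxis w p =
  Complex (even_poly p).[- w ^+ 2] (w * (odd_poly p).[- w ^+ 2]).
Proof.
have sqr_iw : (Complex 0 w) ^+ 2 = real_complex R (- w ^+ 2).
  by rewrite expr2; simpc; rewrite -expr2.
rewrite /iaxis -{1}[p]poly_even_odd rmorphD rmorphM /= !map_comp_poly /=.
rewrite map_polyXn map_polyX hornerD hornerM !horner_comp hornerXn hornerX.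
by rewrite sqr_iw !horner_map /=; simpc; rewrite mulrC.
Qed.

Lemma stable_no_imag_root (R : realType) (p : {poly R}) :
  stable p -> ~ imag_root p.
Proof. by move=> sp [w /eqP]; move/sp; rewrite /= ltxx. Qed.

(** The imaginary part of a real polynomial at i w is divisible by w, which
provides the degeneracy at 0 that parallelogram_exit asks for. *)
Lemma imag_parallelogram (R : realType) (F G H : {poly R}) (l m : R) :
  0 <= l <= 1 -> 0 <= m <= 1 -> imag_root (F + l *: G + m *: H) ->
  exists l' m', on_square_boundary l' m' /\ imag_root (F + l' *: G + m' *: H).
Proof.
move=> lI mI [w ew].
pose re (p : {poly R}) := even_poly p \Po - 'X^2.
pose im (p : {poly R}) := 'X * (odd_poly p \Po - 'X^2).
have reE p x : (re p).[x] = (even_poly p).[- x ^+ 2].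
  by rewrite horner_comp hornerN hornerXn.
have imE p x : (im p).[x] = x * (odd_poly p).[- x ^+ 2].
  by rewrite hornerM hornerX horner_comp hornerN hornerXn.
have comb l' m' x : iaxis x (F + l' *: G + m' *: H) =
    Complex ((re F).[x] + l' * (re G).[x] + m' * (re H).[x])
            ((im F).[x] + l' * (im G).[x] + m' * (im H).[x]).
  rewrite iaxisE !even_polyD !odd_polyD !even_polyZ !odd_polyZ.
  by rewrite !hornerD !hornerZ !reE !imE; congr Complex; ring.
move: ew; rewrite comb => -[e1 e2].
have im0 p : (im p).[0] = 0 by rewrite hornerM hornerX mul0r.
have [l' [m' [x [bd e1' e2']]]] :=
  parallelogram_exit (im0 G) (im0 H) lI mI e1 e2.
by exists l', m'; split=> //; exists x; rewrite comb e1' e2'.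
Qed.

(** * Kharitonov polynomials *)

Lemma coef_sum_ord (R : realType) (m : nat) (c : 'I_m.+1 -> R) (k : nat) :
  (\sum_(j < m.+1) c j *: 'X^j)`_k = if insub k is Some j then c j else 0.
Proof.
rewrite coef_sum; case: insubP => [j _ <-|km].
  rewrite (bigD1 j) //= coefZ coefXn eqxx mulr1 big1 ?addr0 // => i ij.
  by rewrite coefZ coefXn eq_sym val_eqE (negPf ij) mulr0.
rewrite big1 // => i _; rewrite coefZ coefXn.
by case: eqP km => [->|]; rewrite ?ltn_ord ?mulr0.
Qed.

Lemma poly_familyP (R : realType) (m : nat) (r : interval_poly R m)
    (x : {poly R}) :
  poly_family r x <->
  (size x <= m.+1)%N /\ forall k : 'I_m.+1, lower r k <= x`_k <= upper r k.
Proof.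
split=> [[c cI <-]|[sx xI]].
  split=> [|k]; last by rewrite coef_sum_ord valK.
  apply/leq_sizeP => j mj; rewrite coef_sum_ord insubF //.
  by rewrite ltnNge mj.
exists (fun k : 'I_m.+1 => x`_k) => //.
apply/polyP => k; rewrite coef_sum_ord; case: insubP => [j _ -> //|].
by rewrite -leqNgt => mk; rewrite nth_default // (leq_trans sx).
Qed.

Lemma coef_kharitonov (R : realType) (m : nat) (r : interval_poly R m)
    (pat : seq bool) (k : nat) :
  (kharitonov r pat)`_k =
  if insub k is Some j then
    (if nth false pat (k %% 4) then upper r j else lower r j) else 0.
Proof.
rewrite /kharitonov (coef_sum_ord (fun k : 'I_m.+1 =>
  if nth false pat (k %% 4) then upper r k else lower r k)).
by case: insubP => // j _ ->.
Qed.

Lemma kharitonov_family (R : realType) (m : nat) (r : interval_poly R m)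
    (pat : seq bool) : poly_family r (kharitonov r pat).
Proof.
eexists; last by [].
by move=> k /=; case: ifP; rewrite ?lexx ?lower_le_upper.
Qed.

Lemma vertex_kharitonov (R : realType) (m : nat) (r : interval_poly R m)
    (x : {poly R}) :
  kharitonov_vertices r x -> exists pat, x = kharitonov r pat.
Proof. by move=> [[[->|->]|->]|->]; eexists. Qed.

Lemma family_convex (R : realType) (m : nat) (r : interval_poly R m)
    (x y : {poly R}) (t : R) :
  poly_family r x -> poly_family r y -> 0 <= t <= 1 ->
  poly_family r (x + t *: (y - x)).
Proof.
move=> /poly_familyP[sx xI] /poly_familyP[sy yI] /andP[t0 t1].
apply/poly_familyP; split=> [|k].
  rewrite (leq_trans (size_polyD _ _)) // geq_max sx.
  rewrite (leq_trans (size_scale_leq _ _)) //.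
  by rewrite (leq_trans (size_polyD _ _)) // size_polyN geq_max sx sy.
have /andP[xl xu] := xI k; have /andP[yl yu] := yI k.
by rewrite coefD coefZ coefB; apply/andP; split; nra.
Qed.

Lemma horner_le (R : realType) (p q : {poly R}) (y : R) :
  (forall k, p`_k * y ^+ k <= q`_k * y ^+ k) -> p.[y] <= q.[y].
Proof.
move=> pq; rewrite (horner_coef_wide y (leq_maxl (size p) (size q))).
rewrite (horner_coef_wide y (leq_maxr (size p) (size q))).
by apply: ler_sum => k _.
Qed.

Lemma between_param (R : realFieldType) (a b c : R) :
  a <= b <= c -> exists2 l, 0 <= l <= 1 & b = a + l * (c - a).
Proof.
move=> /andP[ab bc]; have [ac|ac] := eqVneq a c.
  by exists 0; rewrite ?lexx ?ler01 // mul0r addr0; apply/eqP; lra.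
have ca : 0 < c - a by rewrite subr_gt0 lt_neqAle ac (le_trans ab bc).
exists ((b - a) / (c - a)); last by rewrite divfK ?gt_eqF // addrC subrK.
by rewrite divr_ge0 ?subr_ge0 ?(le_trans ab bc) //= ler_pdivrMr // mul1r lerB.
Qed.

(** The powers of a nonpositive number alternate in sign: this is why the bounds
alternate inside the even and the odd part of a Kharitonov polynomial. *)
Lemma mul_npos_exp (R : realDomainType) (a b y : R) (k : nat) :
  y <= 0 -> (if odd k then b <= a else a <= b) -> a * y ^+ k <= b * y ^+ k.
Proof.
move=> y0; case: ifP => ok ab.
  by apply: ler_wnM2r ab; rewrite exprn_odd_le0.
by apply: ler_wpM2r ab; rewrite exprn_even_ge0 // ok.
Qed.

(** The even part of a member lies between those of kharitonov1 and kharitonov3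
on the imaginary axis, and the odd part between those of kharitonov1 and
kharitonov2.  The parameters l and u depend on w. *)
Lemma kharitonov_rectangle (R : realType) (m : nat) (r : interval_poly R m)
    (x : {poly R}) (w : R) : poly_family r x ->
  exists l u, [/\ 0 <= l <= 1, 0 <= u <= 1 &
    iaxis w x = iaxis w (kharitonov1 r + l *: (kharitonov3 r - kharitonov1 r)
                         + u *: (kharitonov2 r - kharitonov1 r))].
Proof.
move=> /poly_familyP[sx xI].
pose y : R := - w ^+ 2; have y0 : y <= 0 by rewrite oppr_le0 sqr_ge0.
have coefI (p q : seq bool) (k : nat) (j : nat) :
    nth false p (k %% 4) = odd j -> nth false q (k %% 4) = ~~ odd j ->
    (kharitonov r p)`_k * y ^+ j <= x`_k * y ^+ j <=
    (kharitonov r q)`_k * y ^+ j.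
  rewrite !coef_kharitonov => -> ->; case: insubP => [i _ ik|]; last first.
    by rewrite -leqNgt => mk; rewrite nth_default ?(leq_trans sx) ?mul0r ?lexx.
  have := xI i; rewrite ik => /andP[xl xu].
  by apply/andP; split; apply: mul_npos_exp => //; case: (odd j).
have evenI k : (k.*2 %% 4)%N = (odd k).*2.
  by rewrite -[4%N]/(2 * 2)%N -muln2 -muln_modl modn2 muln2.
have oddI k : (k.*2.+1 %% 4)%N = (odd k).*2.+1.
  by rewrite -addn1 -modnDml evenI addn1; case: (odd k).
have [l lI el] : exists2 l, 0 <= l <= 1 & (even_poly x).[y] =
    (even_poly (kharitonov1 r)).[y] + l *
    ((even_poly (kharitonov3 r)).[y] - (even_poly (kharitonov1 r)).[y]).
  have bnd k : (kharitonov1 r)`_k.*2 * y ^+ k <= x`_k.*2 * y ^+ k <=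
      (kharitonov3 r)`_k.*2 * y ^+ k.
    by apply: coefI; rewrite evenI; case: (odd k).
  apply: between_param; apply/andP; split; apply: horner_le => k;
    by rewrite !coef_even_poly; case/andP: (bnd k).
have [u uI eu] : exists2 l, 0 <= l <= 1 & (odd_poly x).[y] =
    (odd_poly (kharitonov1 r)).[y] + l *
    ((odd_poly (kharitonov2 r)).[y] - (odd_poly (kharitonov1 r)).[y]).
  have bnd k : (kharitonov1 r)`_k.*2.+1 * y ^+ k <= x`_k.*2.+1 * y ^+ k <=
      (kharitonov2 r)`_k.*2.+1 * y ^+ k.
    by apply: coefI; rewrite oddI; case: (odd k).
  apply: between_param; apply/andP; split; apply: horner_le => k;
    by rewrite !coef_odd_poly; case/andP: (bnd k).
have e21 : even_poly (kharitonov2 r) = even_poly (kharitonov1 r).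
  apply/polyP => k; rewrite !coef_even_poly !coef_kharitonov evenI.
  by case: (odd k).
have o31 : odd_poly (kharitonov3 r) = odd_poly (kharitonov1 r).
  apply/polyP => k; rewrite !coef_odd_poly !coef_kharitonov oddI.
  by case: (odd k).
exists l, u; split=> //; rewrite !iaxisE -/y el eu -(scaleN1r (kharitonov1 r)).
rewrite !even_polyD !odd_polyD !even_polyZ !odd_polyZ !even_polyD !odd_polyD.
rewrite !even_polyZ !odd_polyZ e21 o31 !hornerD !hornerZ !hornerD !hornerZ.
by congr Complex; ring.
Qed.

(** The fourth corner of the rectangle. *)
Lemma kharitonov4E (R : realType) (m : nat) (r : interval_poly R m) :
  kharitonov4 r = kharitonov2 r + kharitonov3 r - kharitonov1 r.
Proof.
apply/polyP => k; rewrite coefB coefD !coef_kharitonov.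
case: insubP => [j _ _|_]; last by rewrite subr0 addr0.
by case: (k %% 4)%N (ltn_pmod k (isT : 0 < 4)%N) => [|[|[|[|]]]] //= _; ring.
Qed.

(** The boundary of the parameter square maps to the four Kharitonov edges. *)
Lemma entry_to_edge (R : realType) (m : nat) (r : interval_poly R m)
    (x P Q : {poly R}) :
  poly_family r x -> imag_root (x * P + Q) ->
  exists2 x', kharitonov_edges r x' & imag_root (x' * P + Q).
Proof.
move=> xr [w ew].
have [l [u [lI uI ex]]] := kharitonov_rectangle w xr.
have comb s t : (kharitonov1 r + s *: (kharitonov3 r - kharitonov1 r)
      + t *: (kharitonov2 r - kharitonov1 r)) * P + Q =
    (kharitonov1 r * P + Q) + s *: ((kharitonov3 r - kharitonov1 r) * P)
      + t *: ((kharitonov2 r - kharitonov1 r) * P).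
  by rewrite -!mul_polyC; ring.
have [|l' [u' [/and3P[lI' uI' bd] root']]] := imag_parallelogram lI uI
    (F := kharitonov1 r * P + Q) (G := (kharitonov3 r - kharitonov1 r) * P)
    (H := (kharitonov2 r - kharitonov1 r) * P).
  by exists w; rewrite -comb iaxisD iaxisM -ex -iaxisM -iaxisD.
rewrite -comb in root'; eexists; last exact: root'.
have compl (t : R) : 0 <= t <= 1 -> 0 <= 1 - t <= 1.
  by case/andP=> ? ?; apply/andP; split; lra.
case/or4P: bd => /eqP e.
- left; left; left; exists (1 - u'); first exact: compl.
  by rewrite e -!mul_polyC !polyCB !polyC1; ring.
- left; right; exists u' => //.
  by rewrite e kharitonov4E -!mul_polyC !polyCB !polyC1; ring.
- right; exists l' => //.
  by rewrite e -!mul_polyC !polyCB !polyC1; ring.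
- left; left; right; exists (1 - l'); first exact: compl.
  by rewrite e kharitonov4E -!mul_polyC !polyCB !polyC1; ring.
Qed.

Lemma edge_param (R : realType) (m : nat) (r : interval_poly R m)
    (x : {poly R}) : kharitonov_edges r x ->
  exists p q l, [/\ kharitonov_vertices r p, kharitonov_vertices r q,
    0 <= l <= 1, x = p + l *: (q - p) &
    forall t, 0 <= t <= 1 -> kharitonov_edges r (p + t *: (q - p))].
Proof.
have segE (p q : {poly R}) t : t *: p + (1 - t) *: q = q + t *: (p - q).
  by rewrite -!mul_polyC polyCB polyC1; ring.
move=> [[[]|]|] [l lI <-].
- exists (kharitonov2 r), (kharitonov1 r), l; split=> //.
  + by left; left; right.
  + by left; left; left.
  + by move=> t tI; left; left; left; exists t.
- exists (kharitonov4 r), (kharitonov2 r), l; split=> //.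
  + by right.
  + by left; left; right.
  + by move=> t tI; left; left; right; exists t.
- exists (kharitonov3 r), (kharitonov4 r), l; split=> //.
  + by left; right.
  + by right.
  + by move=> t tI; left; right; exists t.
- exists (kharitonov1 r), (kharitonov3 r), l; split=> //.
  + by left; left; left.
  + by left; right.
  + by move=> t tI; right; exists t.
Qed.

Lemma vertex_edge (R : realType) (m : nat) (r : interval_poly R m)
    (x : {poly R}) : kharitonov_vertices r x -> kharitonov_edges r x.
Proof.
have seg1 (p q : {poly R}) : poly_segment p q p.
  by exists 1; rewrite /= ?ler01 ?lexx // scale1r subrr scale0r addr0.
by move=> [[[->|->]|->]|->];
  [left; left; left|left; left; right|right|left; right].
Qed.

Lemma vertex_family (R : realType) (m : nat) (r : interval_poly R m)
    (x : {poly R}) : kharitonov_vertices r x -> poly_family r x.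
Proof. by move=> /vertex_kharitonov[p ->]; exact: kharitonov_family. Qed.

Lemma edge_family (R : realType) (m : nat) (r : interval_poly R m)
    (x : {poly R}) : kharitonov_edges r x -> poly_family r x.
Proof.
move=> /edge_param[p [q [l [vp vq lI -> _]]]].
by apply: family_convex => //; apply: vertex_family.
Qed.

(** On the boundary of the square one of the two edge parameters is 0 or 1. *)
Lemma edge_pair_to_vertex (R : realType) (m : nat) (r s : interval_poly R m)
    (x y F G H : {poly R}) :
  kharitonov_edges r x -> kharitonov_edges s y ->
  imag_root (F + x * G + y * H) ->
  exists x' y', [/\ kharitonov_edges r x', kharitonov_edges s y',
    kharitonov_vertices r x' \/ kharitonov_vertices s y' &
    imag_root (F + x' * G + y' * H)].
Proof.
move=> /edge_param[p [q [l [vp vq lI -> seg]]]].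
move=> /edge_param[p' [q' [u [vp' vq' uI -> seg']]]].
have comb a b : F + (p + a *: (q - p)) * G + (p' + b *: (q' - p')) * H =
    (F + p * G + p' * H) + a *: ((q - p) * G) + b *: ((q' - p') * H).
  by rewrite -!mul_polyC; ring.
rewrite comb => /(imag_parallelogram lI uI) [l' [u' [/and3P[lI' uI' bd]]]].
rewrite -comb => root'.
exists (p + l' *: (q - p)), (p' + u' *: (q' - p')); split=> //.
- exact: seg.
- exact: seg'.
- by case/or4P: bd => /eqP->; rewrite ?scale0r ?scale1r ?addr0 ?[p + _]addrC
    ?[p' + _]addrC ?subrK; [left|left|right|right].
Qed.

(** * Determinants as functions of the entries *)

Definition set_entry (T : Type) (n q : nat) (N : 'M[T]_(n, q))
    (e : 'I_n * 'I_q) (x : T) : 'M[T]_(n, q) :=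
  \matrix_(i, j) if (i, j) == e then x else N i j.

Definition set_row (T : Type) (n q : nat) (M : 'M[T]_(n, q)) (i : 'I_n)
    (v : 'rV[T]_q) : 'M[T]_(n, q) :=
  \matrix_(k, l) if k == i then v 0 l else M k l.

Definition same_line (n q : nat) (e e' : 'I_n * 'I_q) : bool :=
  (e.1 == e'.1) || (e.2 == e'.2).

Lemma set_entry_id (T : Type) (n q : nat) (N : 'M[T]_(n, q)) e :
  set_entry N e (N e.1 e.2) = N.
Proof. by apply/matrixP => i j; rewrite mxE; case: eqP => // <-. Qed.

Lemma set_entryC (T : Type) (n q : nat) (N : 'M[T]_(n, q)) e e' x y :
  e != e' ->
  set_entry (set_entry N e x) e' y = set_entry (set_entry N e' y) e x.
Proof.
move=> ee; apply/matrixP => i j; rewrite !mxE.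
by case: (eqVneq (i, j) e) ee => [->|//] /negPf->.
Qed.

Lemma det_set_row (R : comNzRingType) (n : nat) (M : 'M[R]_n) (i : 'I_n)
    (u v : 'rV[R]_n) (x : R) :
  \det (set_row M i (u + x *: v)) =
  \det (set_row M i u) + x * \det (set_row M i v).
Proof.
rewrite -[\det (set_row M i u)]mul1r.
apply: (determinant_multilinear (i0 := i)).
- by apply/rowP => l; rewrite !mxE eqxx mul1r.
- by apply/matrixP => k l; rewrite !mxE eq_sym (negPf (neq_lift _ _)).
- by apply/matrixP => k l; rewrite !mxE eq_sym (negPf (neq_lift _ _)).
Qed.

(** Changing one entry of N changes one row of N W, by a multiple of a row of
W. *)
Lemma mul_set_entry (R : comNzRingType) (n q p : nat) (N : 'M[R]_(n, q))
    (W : 'M[R]_(q, p)) (e : 'I_n * 'I_q) (x : R) :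
  set_entry N e x *m W =
  set_row (N *m W) e.1 (row e.1 (set_entry N e 0 *m W) + x *: row e.2 W).
Proof.
case: e => i j; apply/matrixP => k l; rewrite !mxE /=.
case: eqP => [->|/eqP ki]; last first.
  apply: eq_bigr => h _; rewrite mxE; case: eqP => // -[kie].
  by rewrite kie eqxx in ki.
rewrite !(bigD1 (P := xpredT) j) //= !mxE eqxx mul0r add0r addrC.
congr (_ + _); apply: eq_bigr => h hj; rewrite !mxE.
by case: eqP => // -[hje]; rewrite hje eqxx in hj.
Qed.

Lemma det_set_entry (R : comNzRingType) (n q : nat) (N : 'M[R]_(n, q))
    (W : 'M[R]_(q, n)) (e : 'I_n * 'I_q) (x : R) :
  \det (set_entry N e x *m W) =
  x * \det (set_row (N *m W) e.1 (row e.2 W)) + \det (set_entry N e 0 *m W).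
Proof.
rewrite mul_set_entry det_set_row addrC; congr (_ + _).
by rewrite [in RHS]mul_set_entry scale0r addr0.
Qed.

(** On a common row the coefficient of x does not see y.  On a common column the
xy term is a determinant with the same row of W in two places. *)
Lemma det_set_entry2 (R : comNzRingType) (n q : nat) (N : 'M[R]_(n, q))
    (W : 'M[R]_(q, n)) (e e' : 'I_n * 'I_q) : e != e' -> same_line e e' ->
  exists F G H : R, forall x y,
    \det (set_entry (set_entry N e x) e' y *m W) = F + x * G + y * H.
Proof.
move=> ee line.
pose coef y := \det (set_row (set_entry N e' y *m W) e.1 (row e.2 W)).
have [u mulE] : exists u, forall z, set_entry N e' z *m W =
    set_row (N *m W) e'.1 (u + z *: row e'.2 W).
  by exists (row e'.1 (set_entry N e' 0 *m W)) => z; exact: mul_set_entry.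
have coef_cst y : coef y = coef 0.
  rewrite /coef !mulE; have [rows|rows] := eqVneq e.1 e'.1.
    congr (\det _); apply/matrixP => k l; rewrite !mxE -rows.
    by case: eqP.
  have cols : e.2 = e'.2 by move: line; rewrite /same_line (negPf rows) => /eqP.
  have swap (M : 'M[R]_n) (a b : 'rV[R]_n) :
      set_row (set_row M e'.1 a) e.1 b = set_row (set_row M e.1 b) e'.1 a.
    apply/matrixP => k l; rewrite !mxE.
    by case: (eqVneq k e.1) rows => [->|//] /negPf->.
  rewrite !swap !det_set_row cols.
  suff -> : \det (set_row (set_row (N *m W) e.1 (row e'.2 W)) e'.1
                          (row e'.2 W)) = 0 by rewrite !mulr0.
  apply: (determinant_alternate rows) => l.
  by rewrite !mxE !eqxx (negPf rows).
exists (\det (set_entry (set_entry N e 0) e' 0 *m W)), (coef 0),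
  (\det (set_row (set_entry N e 0 *m W) e'.1 (row e'.2 W))) => x y.
rewrite set_entryC // det_set_entry -[X in x * X]/(coef y) coef_cst.
by rewrite -set_entryC // det_set_entry; ring.
Qed.

(** * Reduction to scattered edges *)

(** The graph of M is a partial injection.  A permutation that is right on some
points is corrected at a new one by a transposition, which disturbs none of the
former. *)
Lemma perm_extends_partial (n : nat) (M : 'I_n -> 'I_n -> bool) :
  (forall i j j', M i j -> M i j' -> j = j') ->
  (forall i i' j, M i j -> M i' j -> i = i') ->
  exists sigma : 'S_n, forall i j, M i j -> j = sigma i.
Proof.
move=> rows cols.
suff [sigma hs] : exists sigma : 'S_n,
    forall i, i \in enum 'I_n -> forall j, M i j -> j = sigma i.
  by exists sigma => i; apply: hs; rewrite mem_enum.
elim: (enum 'I_n) => [|i0 s [sigma ih]]; first by exists 1%g.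
have [[j0 M0]|no] := pselect (exists j, M i0 j); last first.
  exists sigma => i; rewrite inE => /predU1P[->|/ih//] j Mj.
  by case: no; exists j.
exists (sigma * tperm (sigma i0) j0)%g => i is_ j Mij; rewrite permM.
have [ii|ii] := eqVneq i i0.
  by rewrite ii tpermL; apply: rows M0; rewrite -ii.
move: is_; rewrite inE (negPf ii) /= => /ih/(_ _ Mij) ji.
rewrite tpermD -?ji //.
- by rewrite ji (inj_eq perm_inj) eq_sym.
- by apply: contraNneq ii => j0j; apply/eqP; apply: cols Mij _; rewrite -j0j.
Qed.

(** The zero moves along the axis at each replacement. *)
Lemma reduce_to_edges (R : realType) (m n q : nat)
    (I : 'I_n -> 'I_q -> interval_poly R m) (N : 'M[{poly R}]_(n, q))
    (W : 'M[{poly R}]_(q, n)) :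
  (forall i j, poly_family (I i j) (N i j)) -> imag_root (\det (N *m W)) ->
  exists N' : 'M[{poly R}]_(n, q),
    (forall i j, kharitonov_edges (I i j) (N' i j)) /\
    imag_root (\det (N' *m W)).
Proof.
move=> famN rootN.
suff [N' [_ edgeN' rootN']] : exists N' : 'M[{poly R}]_(n, q),
    [/\ forall i j, poly_family (I i j) (N' i j),
        forall e, e \in enum {: 'I_n * 'I_q} ->
          kharitonov_edges (I e.1 e.2) (N' e.1 e.2) &
        imag_root (\det (N' *m W))].
  by exists N'; split=> // i j; apply: (edgeN' (i, j)); rewrite mem_enum.
elim: (enum _) => [|e s [M [famM edgeM rootM]]]; first by exists N.
move: rootM; rewrite -[M in M *m W](set_entry_id M e) det_set_entry.
move=> /(entry_to_edge (famM _ _)) [x xe]; rewrite -det_set_entry => rootx.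
exists (set_entry M e x); split=> // [i j|e'].
  by rewrite mxE; case: eqP => [eij|//]; apply: edge_family; rewrite -eij in xe.
rewrite mxE -surjective_pairing inE; case: (eqVneq e' e) => [->//|_ /=].
exact: edgeM.
Qed.

(** Each application of edge_pair_to_vertex to two nonvertex entries on a line
decreases the number of nonvertex entries. *)
Lemma reduce_to_scattered_edges (R : realType) (m n q : nat)
    (I : 'I_n -> 'I_q -> interval_poly R m) (N : 'M[{poly R}]_(n, q))
    (W : 'M[{poly R}]_(q, n)) :
  (forall i j, kharitonov_edges (I i j) (N i j)) -> imag_root (\det (N *m W)) ->
  exists N' : 'M[{poly R}]_(n, q),
    [/\ forall i j, kharitonov_edges (I i j) (N' i j),
        forall e e', same_line e e' ->
          ~ kharitonov_vertices (I e.1 e.2) (N' e.1 e.2) ->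
          ~ kharitonov_vertices (I e'.1 e'.2) (N' e'.1 e'.2) -> e = e' &
        imag_root (\det (N' *m W))].
Proof.
pose nonvertex (M : 'M[{poly R}]_(n, q)) : {set 'I_n * 'I_q} :=
  [set e | ~~ `[< kharitonov_vertices (I e.1 e.2) (M e.1 e.2) >]]%SET.
have nonvertexP (M : 'M[{poly R}]_(n, q)) e :
    reflect (~ kharitonov_vertices (I e.1 e.2) (M e.1 e.2)) (e \in nonvertex M).
  by rewrite inE; exact: asboolPn.
have [k] := ubnP #|nonvertex N|; elim: k N => // k ih N; rewrite ltnS => sz.
move=> edgeN rootN.
have [scattered|] := pselect (forall e e', same_line e e' ->
    e \in nonvertex N -> e' \in nonvertex N -> e = e').
  exists N; split=> // e e' line /nonvertexP ne /nonvertexP ne'.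
  exact: scattered.
move=> /existsNP[e /existsNP[e' /not_implyP[line]]].
move=> /not_implyP[ne /not_implyP[ne']].
move=> /eqP ee.
have [F [G [H FGH]]] := det_set_entry2 N W ee line.
have NE : set_entry (set_entry N e (N e.1 e.2)) e' (N e'.1 e'.2) = N.
  by rewrite !set_entry_id.
move: rootN; rewrite -[N in N *m W]NE FGH.
move=> /(edge_pair_to_vertex (edgeN _ _) (edgeN _ _)) [x [y [xe ye vxy]]].
rewrite -FGH; set M := set_entry _ _ _ => rootM.
have ME e1 : M e1.1 e1.2 =
    if e1 == e' then y else if e1 == e then x else N e1.1 e1.2.
  by rewrite !mxE -surjective_pairing.
apply: (ih M) rootM; last first.
  move=> i j; rewrite -[M i j]/(M (i, j).1 (i, j).2) ME.
  case: eqP => [ij|_]; first by move: ye; rewrite -ij.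
  by case: eqP => [ij|_]; [move: xe; rewrite -ij|exact: edgeN].
apply: leq_trans sz; apply: proper_card; apply/properP; split.
  apply/fintype.subsetP => e1 /nonvertexP; rewrite ME.
  case: (eqVneq e1 e') => [->//|_].
  by case: (eqVneq e1 e) => [->//|_] /nonvertexP.
have [vx|vy] := vxy; [exists e => //|exists e' => //];
  by apply/nonvertexP; rewrite ME ?(negPf ee) eqxx; apply.
Qed.

(** * Perturbation of stable polynomials *)

Import ComplexField.Normc.

Lemma normc_ge0 (R : rcfType) (z : R[i]) : 0 <= normc z.
Proof. by case: z => a b; exact: sqrtr_ge0. Qed.

Lemma ge_Re_normc (R : rcfType) (z : R[i]) : complex.Re z <= normc z.
Proof.
case: z => a b /=; apply: le_trans (ler_norm _) _; rewrite -sqrtr_sqr.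
by apply: ler_wsqrtr; rewrite lerDl sqr_ge0.
Qed.

Lemma normc_real (R : rcfType) (x : R) : normc (real_complex R x) = `|x|.
Proof. by rewrite /= expr0n /= addr0 sqrtr_sqr. Qed.

Lemma normcX (R : rcfType) (z : R[i]) (k : nat) :
  normc (z ^+ k) = normc z ^+ k.
Proof.
by elim: k => [|k ih]; rewrite ?expr0 ?normc1 // !exprS normcM ih.
Qed.

Lemma normc_leB (R : rcfType) (z r : R[i]) : normc z <= normc (z - r) + normc r.
Proof. by rewrite -{1}(subrK r z); exact: le_normcD. Qed.

(** The factor of a stable polynomial at a root r is comparable to 1 + |z| on
the whole closed right half plane, including near infinity. *)
Lemma normc_root_ge (R : rcfType) (r : R[i]) : complex.Re r < 0 ->
  exists2 c : R, 0 < c &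
    forall z, 0 <= complex.Re z -> c * (1 + normc z) <= normc (z - r).
Proof.
move=> r0; pose a := - complex.Re r; have a0 : 0 < a by rewrite oppr_gt0.
have K0 : 0 < 1 + (1 + normc r) / a.
  by rewrite ltr_wpDr // divr_ge0 ?addr_ge0 ?normc_ge0 // ltW.
exists (1 + (1 + normc r) / a)^-1 => [|z z0]; first by rewrite invr_gt0.
rewrite ler_pdivrMl // mulrDl mul1r.
have far : a <= normc (z - r).
  by apply: le_trans (ge_Re_normc _); rewrite raddfB /= lerDr.
have : 1 + normc r <= (1 + normc r) / a * normc (z - r).
  by rewrite mulrAC ler_pdivlMr // ler_wpM2l // addr_ge0 ?normc_ge0.
have := normc_leB z r; lra.
Qed.

Lemma normc_prod_roots_ge (R : rcfType) (rs : seq R[i]) :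
  (forall r, r \in rs -> complex.Re r < 0) ->
  exists2 c : R, 0 < c & forall z, 0 <= complex.Re z ->
    c * (1 + normc z) ^+ size rs <= normc (\prod_(r <- rs) (z - r)).
Proof.
elim: rs => [_|r rs ih neg].
  by exists 1 => // z _; rewrite big_nil expr0 normc1 mulr1.
have [|c c0 hc] := ih; first by move=> s srs; apply: neg; rewrite inE srs orbT.
have [|b b0 hb] := @normc_root_ge R r; first by apply: neg; rewrite inE eqxx.
exists (b * c); first exact: mulr_gt0.
move=> z z0; rewrite big_cons normcM /= exprS mulrACA.
have z1 : 0 <= 1 + normc z by rewrite addr_ge0 ?normc_ge0.
by rewrite ler_pM ?hb ?hc // mulr_ge0 ?exprn_ge0 // ltW.
Qed.

Lemma normc_horner_le (R : rcfType) (p : {poly R[i]}) (d : nat) (z : R[i]) :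
  (size p <= d.+1)%N ->
  normc p.[z] <= (\sum_(k < d.+1) normc p`_k) * (1 + normc z) ^+ d.
Proof.
move=> sp; rewrite (horner_coef_wide z sp) mulr_suml.
apply: (big_ind2 (fun x y => normc x <= y)) => [|x1 x2 y1 y2 h1 h2|k _].
- by rewrite normc0.
- by apply: le_trans (le_normcD _ _) _; exact: lerD.
- rewrite normcM normcX ler_wpM2l ?normc_ge0 //.
  apply: (@le_trans _ _ ((1 + normc z) ^+ k)).
    by rewrite lerXn2r ?nnegrE ?addr_ge0 ?normc_ge0 // lerDr.
  by rewrite ler_weXn2l ?lerDl ?normc_ge0 // -ltnS.
Qed.

Local Notation cpoly p := (map_poly (real_complex _) p).

Lemma stable_neq0 (R : realType) (p : {poly R}) : stable p -> p != 0.
Proof.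
move=> sp; apply/eqP => p0; have := sp 0.
by rewrite p0 rmorph0 root0 ltxx => /(_ isT).
Qed.

Lemma stable_factors (R : realType) (p : {poly R}) : stable p ->
  exists rs : seq R[i], [/\ forall r, r \in rs -> complex.Re r < 0,
    size rs = (size p).-1 &
    forall z, (cpoly p).[z] =
      real_complex R (lead_coef p) * \prod_(r <- rs) (z - r)].
Proof.
move=> sp; have p0 := stable_neq0 sp.
have [rs Ep] := closed_field_poly_normal (cpoly p).
have lc0 : lead_coef (cpoly p) != 0.
  by rewrite lead_coef_map fmorph_eq0 lead_coef_eq0.
exists rs; split.
- move=> r rrs; apply: sp; rewrite Ep rootZ // root_prod_XsubC.
  exact: rrs.
- rewrite -(size_map_poly (real_complex R) p) Ep size_scale //.
  by rewrite size_prod_XsubC.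
- move=> z; rewrite {1}Ep hornerZ horner_prod lead_coef_map; congr (_ * _).
  by apply: eq_bigr => r _; rewrite hornerXsubC.
Qed.

(** On the closed right half plane |p| is at least a multiple of (1 + |z|) ^ d,
and |q| is at most such a multiple.  It matters that p has full degree d: a
perturbation of higher degree may bring a zero from infinity. *)
Lemma stable_open (R : realType) (d : nat) (p q : {poly R}) :
  stable p -> size p = d.+1 -> (size q <= d.+1)%N ->
  exists2 e : R, 0 < e & forall h, `|h| < e -> stable (p + h *: q).
Proof.
move=> sp szp szq; have [rs [neg szrs Ep]] := stable_factors sp.
have [c c0 hc] := normc_prod_roots_ge neg.
pose a := `|lead_coef p|; have a0 : 0 < a.
  by rewrite normr_gt0 lead_coef_eq0 stable_neq0.
have szq' : (size (cpoly q) <= d.+1)%N by rewrite size_map_poly.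
pose C := \sum_(k < d.+1) normc (cpoly q)`_k.
have C0 : 0 <= C by apply: sumr_ge0 => k _; exact: normc_ge0.
have C1 : 0 < C + 1 by rewrite ltr_wpDl.
exists (a * c / (C + 1)); first by rewrite divr_gt0 // mulr_gt0.
move=> h he z rz; rewrite ltNge; apply/negP => z0.
have X0 : 0 < (1 + normc z) ^+ d by rewrite exprn_gt0 // ltr_wpDr ?normc_ge0.
have low : a * (c * (1 + normc z) ^+ d) <= normc (cpoly p).[z].
  rewrite Ep normcM normc_real ler_wpM2l ?(ltW a0) //.
  by have := hc z z0; rewrite szrs szp.
have up := normc_horner_le z szq'; rewrite -/C in up.
have : (cpoly p).[z] = - (real_complex R h * (cpoly q).[z]).
  apply/eqP; rewrite -addr_eq0; move: rz; rewrite rootE.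
  by rewrite rmorphD /= map_polyZ hornerD hornerZ.
move=> /(congr1 (@normc R)); rewrite normcN normcM normc_real => eqn.
move: he; rewrite ltr_pdivlMr // => he.
have := normr_ge0 h; rewrite eqn in low.
have : `|h| * normc (cpoly q).[z] <= `|h| * (C * (1 + normc z) ^+ d).
  by rewrite ler_wpM2l.
nra.
Qed.

(** For every root r, |r| <= (1 + |z| / Re z) |z - r|.  The constant does not
depend on p, so that the bound passes to the limit even if the degree drops. *)
Lemma stable_horner0_le (R : realType) (d : nat) (p : {poly R}) (z : R[i]) :
  0 < complex.Re z -> stable p -> (size p <= d.+1)%N ->
  normc (cpoly p).[0] <=
  (1 + normc z / complex.Re z) ^+ d * normc (cpoly p).[z].
Proof.
move=> z0 sp szp; have [rs [neg szrs Ep]] := stable_factors sp.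
set K := 1 + _; have K1 : 1 <= K by rewrite lerDl divr_ge0 ?normc_ge0 // ltW.
have K0 : 0 <= K by apply: le_trans K1.
have prods : normc (\prod_(r <- rs) (0 - r)) <=
    K ^+ size rs * normc (\prod_(r <- rs) (z - r)).
  elim: rs neg {szrs Ep} => [_|r rs ih neg].
    by rewrite !big_nil expr0 mul1r.
  rewrite !big_cons !normcM /= exprS mulrACA.
  apply: ler_pM; rewrite ?normc_ge0 //; last first.
    by apply: ih => s srs; apply: neg; rewrite inE srs orbT.
  have r0 : complex.Re r < 0 by apply: neg; rewrite inE eqxx.
  have far : complex.Re z <= normc (z - r).
    by apply: le_trans (ge_Re_normc _); rewrite raddfB /= lerDl oppr_ge0 ltW.
  have : normc z <= normc z / complex.Re z * normc (z - r).
    by rewrite mulrAC ler_pdivlMr // ler_wpM2l ?normc_ge0.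
  have := le_normcD (z - r) (- z); rewrite normcN addrAC subrr.
  by rewrite /K; lra.
rewrite !Ep !normcM mulrCA ler_wpM2l ?normc_ge0 //.
apply: le_trans prods _; rewrite ler_wpM2r ?normc_ge0 //.
by rewrite ler_weXn2l // szrs; case: (size p) szp.
Qed.

(** If the limit had a zero in the open right half plane, the bound of
stable_horner0_le would make it vanish at 0, which lies on the imaginary
axis. *)
Lemma stable_limit (R : realType) (p q : {poly R}) :
  (forall e : R, 0 < e -> exists2 h, `|h| < e & stable (p + h *: q)) ->
  ~ imag_root p -> stable p.
Proof.
move=> lim noroot z rz; rewrite ltNge; apply/negP; rewrite le_eqVlt.
case/predU1P => [z0|z0].
  apply: noroot; exists (complex.Im z); apply/eqP.
  by move: rz; case: z z0 => a b /= <-.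
apply: noroot; exists 0; apply: eq0_normc; apply/eqP.
rewrite eq_le normc_ge0 andbT /iaxis; apply/ler_addgt0Pl => e e0.
pose d := maxn (size p) (size q).
pose K := (1 + normc z / complex.Re z) ^+ d.
have K0 : 0 <= K.
  by rewrite exprn_ge0 // addr_ge0 // divr_ge0 ?normc_ge0 // ltW.
pose C := K * normc (cpoly q).[z] + normc (cpoly q).[0].
have C0 : 0 <= C by rewrite addr_ge0 ?mulr_ge0 ?normc_ge0.
have C1 : 0 < C + 1 by rewrite ltr_wpDl.
have [h he sh] := lim (e / (C + 1)) (divr_gt0 e0 C1).
have Eh x : (cpoly (p + h *: q)).[x] =
    (cpoly p).[x] + real_complex R h * (cpoly q).[x].
  by rewrite rmorphD /= map_polyZ hornerD hornerZ.
have szh : (size (p + h *: q)%R <= d.+1)%N.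
  rewrite ltnW // ltnS (leq_trans (size_polyD _ _)) // geq_max leq_maxl /=.
  by rewrite (leq_trans (size_scale_leq _ _)) // leq_maxr.
have := stable_horner0_le z0 sh szh; rewrite -/K !Eh.
rewrite (rootP rz) add0r normcM normc_real => le1.
rewrite -[Complex 0 0]/(0 : R[i]) addr0.
have := normc_leB (cpoly p).[0] (- (real_complex R h * (cpoly q).[0])).
rewrite opprK normcN normcM normc_real => le2.
apply: (@le_trans _ _ (`|h| * C)); first by rewrite /C; lra.
move: he; rewrite ltr_pdivlMr //; have := normr_ge0 h; nra.
Qed.

(** The condition on the coefficients of degree d keeps the degree equal to d
for t < 1.  At the infimum of the parameters of unstable polynomials, stability
holds by stable_limit and extends further by stable_open. *)
Lemma stable_segment (R : realType) (d : nat) (p0 p1 : {poly R}) :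
  stable p0 -> size p0 = d.+1 -> (size p1 <= d.+1)%N -> 0 <= p0`_d * p1`_d ->
  (forall t, 0 <= t <= 1 -> ~ imag_root (p0 + t *: (p1 - p0))) ->
  stable p1.
Proof.
move=> s0 sz0 sz1 lc01 noroot; pose pt t := p0 + t *: (p1 - p0).
have pt1 : pt 1 = p1 by rewrite /pt scale1r addrC subrK.
have ptD t h : pt (t + h) = pt t + h *: (p1 - p0).
  by rewrite /pt scalerDl addrA.
have szq : (size (p1 - p0)%R <= d.+1)%N.
  by rewrite (leq_trans (size_polyD _ _)) // size_polyN geq_max sz1 sz0 /=.
apply: contrapT => uns1.
pose U : set R := [set t | 0 <= t <= 1 /\ ~ stable (pt t)].
have U1 : U 1 by split; rewrite ?pt1 ?ler01 ?lexx.
have lbU : lbound U 0 by move=> t [/andP[]].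
have infU : has_inf U by split; [exists 1|exists 0].
pose tau := inf U.
have tau0 : 0 <= tau by apply: lb_le_inf lbU; exists 1.
have tau1 : tau <= 1 by apply: ge_inf => //; case: infU.
have before t : 0 <= t -> t < tau -> stable (pt t).
  move=> t0 ttau; apply: contrapT => ut; move: (ttau).
  rewrite ltNge => /negP; apply.
  apply: ge_inf; first by case: infU.
  by split; rewrite ?t0 // (le_trans _ tau1) // ltW.
have stau : stable (pt tau).
  have [tau_eq0|tau_neq0] := eqVneq tau 0.
    by rewrite tau_eq0 /pt scale0r addr0.
  have taup : 0 < tau by rewrite lt_def tau_neq0.
  apply: (@stable_limit _ _ (p1 - p0)); last by apply: noroot; rewrite tau0.
  move=> e e0; exists (- Num.min (e / 2) tau).
    by rewrite normrN gtr0_norm ?lt_min ?taup ?divr_gt0 // gt_min; apply/orP;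
      left; lra.
  have m0 : 0 < Num.min (e / 2) tau by rewrite lt_min taup divr_gt0.
  have mt : Num.min (e / 2) tau <= tau by rewrite ge_min lexx orbT.
  by rewrite -ptD; apply: before; lra.
have tault1 : tau < 1.
  rewrite lt_neqAle tau1 andbT; apply/eqP => t1.
  by apply: uns1; rewrite -pt1 -t1.
have lc0 : p0`_d != 0.
  by have := stable_neq0 s0; rewrite -lead_coef_eq0 lead_coefE sz0.
have sztau : size (pt tau) = d.+1.
  apply/eqP; rewrite eqn_leq; apply/andP; split.
    rewrite (leq_trans (size_polyD _ _)) // geq_max sz0 leqnn /=.
    by rewrite (leq_trans (size_scale_leq _ _)).
  rewrite ltnNge; apply/negP => /leq_sizeP/(_ d (leqnn d)).
  rewrite coefD coefZ coefB => lctau.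
  have lc2 : 0 < p0`_d ^+ 2 by rewrite exprn_even_gt0.
  have : p0`_d * (p0`_d + tau * (p1`_d - p0`_d)) = 0 by rewrite lctau mulr0.
  nra.
have [e e0 he] := stable_open stau sztau szq.
have [t [tI ut] tlt] := inf_adherent e0 infU.
have tge : tau <= t by apply: ge_inf => //; case: infU.
apply: ut; rewrite -[t](subrK tau) addrC ptD; apply: he.
by rewrite ger0_norm ?subr_ge0 // ltrBlDl.
Qed.

Lemma coefM_lead (R : comNzRingType) (k : nat) (y P : {poly R}) :
  (size y <= k.+1)%N -> (y * P)`_(k + (size P).-1) = y`_k * lead_coef P.
Proof.
move=> szy; rewrite coefM (bigD1 (inord k)) //= inordK ?ltnS ?leq_addr //.
rewrite addKn -lead_coefE big1 ?addr0 // => i /negP ik.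
have [lt_ki|le_ik] := ltnP k i.
  by rewrite nth_default ?mul0r // (leq_trans szy).
rewrite [P`__]nth_default ?mulr0 //.
have {le_ik}ik' : (i < k)%N.
  rewrite ltn_neqAle le_ik andbT; apply/negP => /eqP e; apply: ik.
  by apply/eqP/val_inj; rewrite /= inordK ?ltnS ?leq_addr.
have arith a b c : (a < b -> c <= b + c.-1 - a)%N by lia.
exact: arith.
Qed.

(** * From vertices to the whole family *)

(** Kharitonov's theorem with a multiplier and an offset, from vertices to the
whole family, given that no member vanishes on the imaginary axis. *)
Lemma kharitonov_entry_stable (R : realType) (m : nat) (r : interval_poly R m)
    (P Q x : {poly R}) :
  (forall v, kharitonov_vertices r v -> stable (v * P + Q)) ->
  (forall y, poly_family r y -> ~ imag_root (y * P + Q)) ->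
  poly_family r x -> stable (x * P + Q).
Proof.
move=> sv noroot xr; have /poly_familyP[szx xI] := xr.
have [PE|P0] := eqVneq P 0.
  have := sv (kharitonov1 r); rewrite PE !mulr0 !add0r; apply.
  by left; left; left.
have segment v d : kharitonov_vertices r v -> size (v * P + Q) = d.+1 ->
    (size (x * P + Q)%R <= d.+1)%N ->
    0 <= (v * P + Q)`_d * (x * P + Q)`_d -> stable (x * P + Q).
  move=> vr szv szxPQ lc.
  apply: (stable_segment (sv v vr) szv szxPQ lc) => t tI.
  have -> : v * P + Q + t *: (x * P + Q - (v * P + Q)) =
      (v + t *: (x - v)) * P + Q by rewrite -!mul_polyC; ring.
  by apply: noroot; apply: family_convex => //; exact: vertex_family.
have famD y k : poly_family r y ->
    (forall l : 'I_m.+1, (k < l)%N -> lower r l = upper r l) ->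
    (size (x - y)%R <= k.+1)%N.
  move=> /poly_familyP[szy yI] deg; apply/leq_sizeP => l kl; rewrite coefB.
  have [lm|ml] := ltnP l m.+1; last first.
    by rewrite !nth_default ?subrr // (leq_trans _ ml).
  have := xI (Ordinal lm); have := yI (Ordinal lm).
  rewrite (deg (Ordinal lm) kl) /=.
  by move=> /le_anti <- /le_anti <-; rewrite subrr.
have [all_deg|] := pselect (forall l, lower r l = upper r l).
  have -> : x = kharitonov1 r; last by apply: sv; left; left; left.
  have /poly_familyP[szk kI] : poly_family r (kharitonov1 r).
    exact: kharitonov_family.
  apply/polyP => l; have [lm|ml] := ltnP l m.+1; last first.
    by rewrite !nth_default // (leq_trans _ ml).
  have := xI (Ordinal lm); have := kI (Ordinal lm); rewrite all_deg /=.
  by move=> /le_anti <- /le_anti <-.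
move=> /existsNP[l0 /eqP l0P].
have [k kP kmax] := @arg_maxnP _ l0 (fun l => lower r l != upper r l) val l0P.
have deg (l : 'I_m.+1) : (k < l)%N -> lower r l = upper r l.
  move=> kl; apply/eqP; apply: contraTT kl => /kmax; by rewrite -leqNgt.
have klt : lower r k < upper r k by rewrite lt_neqAle kP lower_le_upper.
(* the largest degree in which x * P + Q depends on x *)
pose e := (k + (size P).-1)%N.
have diff v : x * P + Q = v * P + Q + (x - v) * P by ring.
have szdiff v : kharitonov_vertices r v -> (size ((x - v) * P)%R <= e.+1)%N.
  move=> /vertex_family/famD/(_ deg) szD.
  apply: leq_trans (size_polyMleq _ _) _; rewrite /e.
  by move: szD; rewrite -(prednK (n := size P)) ?size_poly_gt0 //=; lia.
have coefe v : kharitonov_vertices r v ->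
    (x * P + Q)`_e = (v * P + Q)`_e + (x`_k - v`_k) * lead_coef P.
  move=> /vertex_family/famD/(_ deg) szD.
  by rewrite (diff v) coefD coefM_lead // coefB.
have v1 : kharitonov_vertices r (kharitonov1 r) by left; left; left.
(* if Q imposes a larger degree, the leading coefficient is constant *)
have [lt_e|le_e] := ltnP e.+1 (size (kharitonov1 r * P + Q)%R).
  pose d := (size (kharitonov1 r * P + Q)%R).-1.
  have szd : size (kharitonov1 r * P + Q) = d.+1.
    by rewrite prednK // (leq_trans _ lt_e).
  have ed : (e.+1 <= d)%N by rewrite -ltnS -szd.
  apply: (segment _ d v1 szd).
    rewrite (diff (kharitonov1 r)) (leq_trans (size_polyD _ _)) // geq_max.
    rewrite szd leqnn /=.
    by rewrite (leq_trans (szdiff _ v1)) // ltnW.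
  suff -> : (x * P + Q)`_d = (kharitonov1 r * P + Q)`_d.
    by rewrite -expr2 sqr_ge0.
  rewrite (diff (kharitonov1 r)) coefD [((x - _) * P)`_d]nth_default ?addr0 //.
  exact: leq_trans (szdiff _ v1) ed.
have szxPQ : (size (x * P + Q)%R <= e.+1)%N.
  rewrite (diff (kharitonov1 r)) (leq_trans (size_polyD _ _)) // geq_max le_e.
  exact: szdiff.
have szv v : kharitonov_vertices r v -> (size (v * P + Q)%R <= e.+1)%N.
  move=> vr; have -> : v * P + Q = x * P + Q - (x - v) * P by ring.
  by rewrite (leq_trans (size_polyD _ _)) // size_polyN geq_max szxPQ szdiff.
have pick v : kharitonov_vertices r v -> (v * P + Q)`_e != 0 ->
    0 <= (v * P + Q)`_e * (x * P + Q)`_e -> stable (x * P + Q).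
  move=> vr ve0; apply: segment => //; apply/eqP; rewrite eqn_leq szv //=.
  by rewrite ltnNge; apply/negP => /leq_sizeP/(_ e (leqnn e)) /eqP; apply/negP.
(* vertices at both ends of the range of the coefficient of degree k *)
have [vL [vLr vLk]] : exists v, kharitonov_vertices r v /\ v`_k = lower r k.
  have k4 := ltn_pmod k (isT : 0 < 4)%N.
  have [lt2|ge2] := ltnP (k %% 4) 2.
    exists (kharitonov1 r); split=> //; rewrite coef_kharitonov valK.
    by case: (k %% 4)%N lt2 => [|[|]].
  have [eq2|ne2] := eqVneq (k %% 4)%N 2.
    exists (kharitonov3 r); split; first by left; right.
    by rewrite coef_kharitonov valK eq2.
  exists (kharitonov2 r); split; first by left; left; right.
  rewrite coef_kharitonov valK.
  by case: (k %% 4)%N k4 ge2 ne2 => [|[|[|[|]]]].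
have [vU [vUr vUk]] : exists v, kharitonov_vertices r v /\ v`_k = upper r k.
  have k4 := ltn_pmod k (isT : 0 < 4)%N.
  have [lt2|ge2] := ltnP (k %% 4) 2.
    exists (kharitonov4 r); split; first by right.
    rewrite coef_kharitonov valK.
    by case: (k %% 4)%N lt2 => [|[|]].
  exists (kharitonov1 r); split=> //; rewrite coef_kharitonov valK.
  by case: (k %% 4)%N k4 ge2 => [|[|[|[|]]]].
have lcP0 : lead_coef P != 0 by rewrite lead_coef_eq0.
have eL := coefe _ vLr; rewrite vLk in eL.
have eU := coefe _ vUr; rewrite vUk in eU.
have /andP[xl xu] := xI k.
move: eL eU (pick vL vLr) (pick vU vUr).
set gx := (x * P + Q)`_e; set gL := (vL * P + Q)`_e; set gU := (vU * P + Q)`_e.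
move=> eL eU pickL pickU.
have [bL|bL] := boolP ((gL != 0) && (0 <= gL * gx)).
  by case/andP: bL; exact: pickL.
have [bU|bU] := boolP ((gU != 0) && (0 <= gU * gx)).
  by case/andP: bU; exact: pickU.
have nonpos g : ~~ ((g != 0) && (0 <= g * gx)) -> g * gx <= 0.
  by rewrite negb_and negbK -ltNge => /orP[/eqP->|/ltW//]; rewrite mul0r.
have nL := nonpos _ bL; have nU := nonpos _ bU.
(* gx lies between gL and gU; they cannot both be zero or of sign
   opposite to that of gx, since gL and gU differ *)
have conv : (upper r k - lower r k) * gx =
    (upper r k - x`_k) * gL + (x`_k - lower r k) * gU.
  transitivity ((upper r k - x`_k) * gx + (x`_k - lower r k) * gx).
    by ring.
  by rewrite {1}eL {1}eU; ring.
have gx0 : gx = 0.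
  apply/eqP; rewrite -sqrf_eq0 eq_le sqr_ge0 andbT.
  rewrite -(pmulr_rle0 _ (_ : 0 < upper r k - lower r k)) ?subr_gt0 //.
  by rewrite expr2 mulrA conv; nra.
have zero g : ~~ ((g != 0) && (0 <= g * gx)) -> g = 0.
  by rewrite gx0 mulr0 lexx andbT negbK => /eqP.
have /eqP : (upper r k - lower r k) * lead_coef P = 0.
  rewrite (zero _ bL) in eL; rewrite (zero _ bU) in eU.
  by rewrite -(subrr gx) {1}eL {1}eU; ring.
by rewrite mulf_eq0 (negPf lcP0) orbF subr_eq0 eq_sym (lt_eqF klt).
Qed.
(** Replace vertices by arbitrary members one entry at a time: when an entry is
treated, the matrices with a vertex in its place are stable by induction. *)
Lemma kharitonov_mx_stable (R : realType) (m n q : nat)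
    (I : 'I_n -> 'I_q -> interval_poly R m) (W : 'M[{poly R}]_(q, n)) :
  (forall N : 'M[{poly R}]_(n, q),
     (forall i j, kharitonov_vertices (I i j) (N i j)) ->
     stable (\det (N *m W))) ->
  (forall N : 'M[{poly R}]_(n, q),
     (forall i j, poly_family (I i j) (N i j)) ->
     ~ imag_root (\det (N *m W))) ->
  forall N : 'M[{poly R}]_(n, q), (forall i j, poly_family (I i j) (N i j)) ->
    stable (\det (N *m W)).
Proof.
move=> sv noroot.
suff gen (s : seq ('I_n * 'I_q)) (N : 'M[{poly R}]_(n, q)) :
    (forall e, poly_family (I e.1 e.2) (N e.1 e.2)) ->
    (forall e, e \notin s -> kharitonov_vertices (I e.1 e.2) (N e.1 e.2)) ->
    stable (\det (N *m W)).
  move=> N famN; apply: (gen (enum {: 'I_n * 'I_q})) => [e //|e].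
  by rewrite mem_enum.
elim: s N => [|e s ih] N famN vN.
  by apply: sv => i j; apply: (vN (i, j)).
have famset x : poly_family (I e.1 e.2) x ->
    forall e', poly_family (I e'.1 e'.2) (set_entry N e x e'.1 e'.2).
  move=> xe e'; rewrite mxE -surjective_pairing.
  by case: (eqVneq e' e) => [->//|_]; exact: famN.
rewrite -(set_entry_id N e) det_set_entry.
apply: (kharitonov_entry_stable (r := I e.1 e.2)) => // [v ve|y ye].
  rewrite -det_set_entry; apply: ih => [|e' e's].
    by apply: famset; exact: vertex_family.
  rewrite mxE -surjective_pairing; case: (eqVneq e' e) => [->//|ne].
  by apply: vN; rewrite inE negb_or ne.
rewrite -det_set_entry; apply: noroot => i j; exact: (famset y ye (i, j)).
Qed.

(** * Membership in the test set *)

(** The choice function eta picks, in each row, the column of the only nonvertex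
entry of B or D, if there is one. *)
Lemma scattered_edges_mem (R : realType) (n m : nat) (B D : interval_mx R n m)
    (Bs Ds : 'M[{poly R}]_n) :
  (forall i j, kharitonov_edges (B i j) (Bs i j)) ->
  (forall i j, kharitonov_edges (D i j) (Ds i j)) ->
  (forall i i' j j', (i == i') || (j == j') ->
     ~ kharitonov_vertices (B i j) (Bs i j) ->
     ~ kharitonov_vertices (B i' j') (Bs i' j') -> i = i' /\ j = j') ->
  (forall i i' j j', (i == i') || (j == j') ->
     ~ kharitonov_vertices (D i j) (Ds i j) ->
     ~ kharitonov_vertices (D i' j') (Ds i' j') -> i = i' /\ j = j') ->
  (forall i j j', ~ kharitonov_vertices (B i j) (Bs i j) ->
     kharitonov_vertices (D i j') (Ds i j')) ->
  (mx_row_edge_pairs B D `&` mx_edge_pairs B D) (Bs, Ds).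
Proof.
move=> eB eD sB sD sBD.
have edges (X : interval_mx R n m) (M : 'M[{poly R}]_n) :
    (forall i j, kharitonov_edges (X i j) (M i j)) ->
    (forall i i' j j', (i == i') || (j == j') ->
      ~ kharitonov_vertices (X i j) (M i j) ->
      ~ kharitonov_vertices (X i' j') (M i' j') -> i = i' /\ j = j') ->
    mx_edges X M.
  move=> eX sX; split=> [i j|]; first exact: edge_family.
  have [| |sigma hs] := @perm_extends_partial n
      (fun i j => ~~ `[< kharitonov_vertices (X i j) (M i j) >]).
  - move=> i j j' /asboolPn v /asboolPn v'.
    by have [] := sX i i j j' _ v v'; rewrite ?eqxx.
  - move=> i i' j /asboolPn v /asboolPn v'.
    by have [] := sX i i' j j _ v v'; rewrite ?eqxx ?orbT.
  exists sigma => i j; case: eqP => [_|nj]; first exact: eX.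
  by apply: contrapT => nv; apply: nj; apply: hs; apply/asboolPn.
have famB : mx_family B Bs by move=> i j; exact: edge_family.
have famD : mx_family D Ds by move=> i j; exact: edge_family.
split; last by split; apply: edges.
split=> //; pose edge_at i (j : 'I_n) :=
  ~~ `[< kharitonov_vertices (B i j) (Bs i j) /\
         kharitonov_vertices (D i j) (Ds i j) >].
exists [ffun i => odflt i [pick j | edge_at i j]] => i j; rewrite ffunE /=.
have [vB|nvB] := pselect (kharitonov_vertices (B i j) (Bs i j)); last first.
  have vD := sBD i j j nvB.
  case: pickP => [j' /asboolPn ej'|/(_ j)/negPn/asboolP[//]] /=.
  suff <- : j = j' by rewrite eqxx; left.
  apply: contrapT => jj'; apply: ej'; split; last exact: sBD nvB.
  by apply: contrapT => nv; have [] := sB i i j j' _ nvB nv; rewrite ?eqxx.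
have [vD|nvD] := pselect (kharitonov_vertices (D i j) (Ds i j)).
  by case: ifP => _ //; left.
case: pickP => [j' /asboolPn ej'|/(_ j)/negPn/asboolP[//]] /=.
suff <- : j = j' by rewrite eqxx; right.
apply: contrapT => jj'; apply: ej'; split; apply: contrapT => nv.
  by apply: nvD; exact: sBD nv.
by have [] := sD i i j j' _ nvD nv; rewrite ?eqxx.
Qed.

Theorem theorem1 (R : realType) (n m : nat) (A C : 'M[{poly R}]_n)
    (B D : interval_mx R n m) :
  (forall Bs Ds : 'M[{poly R}]_n, mx_family B Bs -> mx_family D Ds ->
     stable_mx (Bs *m A + Ds *m C)) <->
  (forall Bs Ds : 'M[{poly R}]_n,
     (mx_row_edge_pairs B D `&` mx_edge_pairs B D) (Bs, Ds) ->
     stable_mx (Bs *m A + Ds *m C)).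
Proof.
split=> [all_stable Bs Ds [[[famB famD] _] _]|edge_stable].
  exact: all_stable.
pose I (i : 'I_n) (j : 'I_(n + n)) :=
  match split j with inl k => B i k | inr k => D i k end.
have IB i k : I i (lshift n k) = B i k by rewrite /I (unsplitK (inl k)).
have ID i k : I i (rshift n k) = D i k by rewrite /I (unsplitK (inr k)).
pose W := col_mx A C.
have scattered_stable (N : 'M[{poly R}]_(n, n + n)) :
    (forall i j, kharitonov_edges (I i j) (N i j)) ->
    (forall e e', same_line e e' ->
      ~ kharitonov_vertices (I e.1 e.2) (N e.1 e.2) ->
      ~ kharitonov_vertices (I e'.1 e'.2) (N e'.1 e'.2) -> e = e') ->
    stable (\det (N *m W)).
  move=> eN sN; rewrite -[N]hsubmxK mul_row_col; apply: edge_stable.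
  have NB i k : lsubmx N i k = N i (lshift n k) by rewrite mxE.
  have ND i k : rsubmx N i k = N i (rshift n k) by rewrite mxE.
  apply: scattered_edges_mem =>
    [i k|i k|i i' k k' line nv nv'|i i' k k' line nv nv'|i k k' nv].
  - by rewrite NB -IB.
  - by rewrite ND -ID.
  - have := sN (i, lshift n k) (i', lshift n k').
    rewrite /same_line /= !IB -!NB (inj_eq (@lshift_inj _ _)).
    by move=> /(_ line nv nv') [-> /val_inj].
  - have := sN (i, rshift n k) (i', rshift n k').
    rewrite /same_line /= !ID -!ND (inj_eq (@rshift_inj _ _)).
    by move=> /(_ line nv nv') [-> /addnI/val_inj].
  - apply: contrapT => nv'; have := sN (i, lshift n k) (i, rshift n k').
    rewrite /same_line /= eqxx IB ID -NB -ND => /(_ isT nv nv') [].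
    by move=> kE; have := ltn_ord k; rewrite kE ltnNge leq_addr.
move=> Bs Ds famB famD; rewrite /stable_mx -mul_row_col.
apply: (kharitonov_mx_stable (I := I)) => [N vN|N famN rootN|i j].
- apply: scattered_stable => [i j|e e' _ nv]; first exact: vertex_edge.
  by case: nv; exact: vN.
- have [N1 [eN1 rootN1]] := reduce_to_edges famN rootN.
  have [N2 [eN2 sN2 rootN2]] := reduce_to_scattered_edges eN1 rootN1.
  exact: stable_no_imag_root (scattered_stable N2 eN2 sN2) rootN2.
- case: (split_ordP j) => k ->; rewrite ?row_mxEl ?row_mxEr ?IB ?ID.
    exact: famB.
  exact: famD.
Qed.
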